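(* Let $(X,|\cdot|_X)$ and $(Y,|\cdot|_Y)$ be real Banach spaces and let $f:X\to Y$ be a local $C^1$-diffeomorphism. For $y\in Y$ let $F_y:X\to\mathbb{R}$, $F_y(x)=\frac12|f(x)-y|_Y^2$. Let $h:[0,+\infty)\to[0,+\infty)$ be a continuous nondecreasing function such that $\int_0^\infty\frac{1}{1+h(\rho)}\,d\rho=+\infty$. Suppose that for each $y\in Y$, every sequence $\{x_n\}$ in $X$ such that $$\lim_{n\to\infty}F_y(x_n)=0\quad\text{and}\quad \lim_{n\to\infty}\lambda_{F_y}(x_n)(1+h(|x_n|_X))=0$$ has a norm-convergent subsequence. Then $f$ is onto.
   Context: A map $f:X\to Y$ is a local $C^1$-diffeomorphism if it is $C^1$ and $df(x)$ is a linear isomorphism of $X$ onto $Y$ for every $x\in X$. For a locally Lipschitz functional $F:X\to\mathbb{R}$ on a real Banach space $X$ with dual $X^*$, the generalized directional derivative is $F^0(x;v)=\limsup_{z\to 0,\ t\downarrow 0}\frac1t\left(F(x+z+tv)-F(x+z)\right)$, the Clarke generalized gradient is $\partial F(x)=\{w^*\in X^*: \langle w^*,v\rangle\le F^0(x;v)\ \forall v\in X\}$ (a nonempty convex weak*-compact set), and $\lambda_F(x)=\min_{w^*\in\partial F(x)}|w^*|_{X^*}$. *)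

(* Defs.v *)
From HB Require Import structures.
From mathcomp Require Import all_boot all_order all_algebra.
From mathcomp Require Import all_classical all_reals all_analysis.

Set Implicit Arguments.
Unset Strict Implicit.
Unset Printing Implicit Defensive.

Import Order.TTheory GRing.Theory Num.Theory.
Import numFieldNormedType.Exports.

Local Open Scope classical_set_scope.
Local Open Scope ring_scope.

(* Meant for bounded linear maps; [sup] is real-valued, so the value is 0 by
   convention when [g] is unbounded on the closed unit ball. *)
Definition opnorm (R : realType) (V W : normedModType R) (g : V -> W) : R :=
  sup [set `|g v| | v in [set v : V | `|v| <= 1]].

(* [differentiable] is Frechet differentiability and includes the continuity
   of the linear map ['d f x], so every [opnorm] below is a genuine supremum. *)
Definition is_C1 (R : realType) (X Y : normedModType R) (f : X -> Y) : Prop :=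
  (forall x, differentiable f x) /\
  (forall x, opnorm ('d f z \- 'd f x) @[z --> x] --> (0 : R)).

Definition local_C1_diffeomorphism (R : realType) (X Y : normedModType R)
    (f : X -> Y) : Prop :=
  is_C1 f /\ forall x, bijective ('d f x).

Definition clarke_derivative (R : realType) (X : normedModType R) (F : X -> R)
    (x v : X) : \bar R :=
  limf_esup
    (fun p : X * R => (p.2^-1 * (F (x + p.1 + p.2 *: v) - F (x + p.1)))%:E)
    (filter_prod (nbhs (0 : X)) (0 : R)^'+).

(* The dual of [X] consists of the continuous elements of
   [{linear X -> R^o}]. *)
Definition clarke_gradient (R : realType) (X : normedModType R) (F : X -> R)
    (x : X) : set {linear X -> R^o} :=
  [set w : {linear X -> R^o} | continuous w /\
     forall v, ((w v : R)%:E <= clarke_derivative F x v)%E].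

(* For a locally Lipschitz [F] the gradient is nonempty and weak*-compact, so
   this infimum is a minimum. *)
Definition clarke_lambda (R : realType) (X : normedModType R) (F : X -> R)
    (x : X) : R :=
  inf [set opnorm w | w in clarke_gradient F x].

Definition half_sq_dist (R : realType) (X Y : normedModType R) (f : X -> Y)
    (y : Y) (x : X) : R :=
  2^-1 * `|f x - y| ^+ 2.

Definition has_convergent_subseq (R : realType) (X : normedModType R)
    (u : nat -> X) : Prop :=
  exists phi : nat -> nat,
    {homo phi : m n / (m < n)%N} /\ cvgn (fun n => u (phi n)).

(* Main.v *)
Require Import Defs.
From HB Require Import structures.
From mathcomp Require Import all_boot all_order all_algebra.
From mathcomp Require Import all_classical all_reals all_analysis.
From mathcomp Require Import ring lra.
Import Order.TTheory GRing.Theory Num.Theory.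
Import numFieldNormedType.Exports.
Local Open Scope classical_set_scope.
Local Open Scope ring_scope.
Set Implicit Arguments.
Unset Strict Implicit.
Unset Printing Implicit Defensive.

(* The range of [f] is open and closed in the connected space [Y].

   Closed: if [y] is in the closure of the range, Ekeland's principle for [F_y]
   with the weight [e / (1 + h |x|)] gives points [z] with [F_y z <= e] and
   [F_y x >= F_y z - e |x - z| / (1 + h |z|)] for all [x]. The weighted principle
   holds because [Phi r = \int_0^r 1 / (1 + h)] is concave and unbounded, so that
   [e Phi |x|] controls the norm along descending sequences. Writing
   [F_y (z + v) = phi (f z - y + 'd f z v) + o(v)] with [phi = |.|^2 / 2] convex,
   a Hahn-Banach sandwich produces an element of the Clarke gradient of norm at
   most [e / (1 + h |z|)]. The compactness hypothesis then yields a limit point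
   at which [F_y] vanishes.

   Open: by Baire, ['d f x0] has approximate preimages of controlled norm.
   Ekeland's principle for [x |-> |f x - y|] with a constant weight gives a point
   near [x0] where that function cannot decrease at a small positive rate, which
   is impossible unless the function vanishes there. *)

(** * Ekeland's variational principle with a variable weight *)

(** Selection rule for the chain of [weighted_ekeland]: one can always go halfway down to the
    infimum of [F] over [S x], and [x] itself serves when [F x] is already that infimum. *)
Lemma near_minimizer (R : realType) (X : Type) (F : X -> R)
    (S : X -> X -> Prop) :
  (forall x, 0 <= F x) -> (forall x, S x x) ->
  forall x, exists2 x', S x x' & forall u, S x u -> F x' <= (F x + F u) / 2.
Proof.
move=> F0 Sxx x; pose A := F @` S x; pose i := inf A.
have lbA : has_lbound A by exists 0 => _ [u _ <-].
have iF u : S x u -> i <= F u by move=> Su; apply: ge_inf => //; exists u.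
have [Fi|iltF] := leP (F x) i.
  by exists x => // u /iF iu; lra.
have [||_ [x' Sx' <-] Fx'] := @inf_adherent _ A ((F x - i) / 2).
- by lra.
- by split=> //; exists (F x), x.
by exists x' => // u /iF iu; rewrite -/i in Fx'; lra.
Qed.

(* The relation [F y + w x * `|y - x| <= F x] is not transitive, as the weight is
   taken at the starting point; the potential [psi] is what keeps a descending
   chain inside a region where [w] is bounded below. *)
Lemma weighted_ekeland (R : realType) (X : completeNormedModType R)
    (F w psi : X -> R) (c : R) (x0 : X) :
  continuous F -> (forall x, 0 <= F x) -> continuous w ->
  (forall x y, psi y - psi x <= w x * `|y - x|) ->
  0 < c -> (forall x, psi x <= psi x0 + F x0 -> c <= w x) ->
  exists z, [/\ F z <= F x0, psi z <= psi x0 + F x0 &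
                forall x, F z - w z * `|x - z| <= F x].
Proof.
move=> Fc F0 wc wpsi c0 cw.
pose S x y := F y + w x * `|y - x| <= F x.
have Sxx x : S x x by rewrite /S subrr normr0 mulr0 addr0.
have [g gS gF] : exists2 g : X -> X, forall x, S x (g x) &
    forall x u, S x u -> F (g x) <= (F x + F u) / 2.
  have /choice[g gP] : forall x, exists x', S x x' /\
      forall u, S x u -> F x' <= (F x + F u) / 2.
    by move=> x; have [x' ? ?] := near_minimizer (S := S) F0 Sxx x; exists x'.
  by exists g => x; [exact: (gP x).1|exact: (gP x).2].
pose u n := iter n g x0.
have uS n : S (u n) (u n.+1) by exact: gS.
(* Adding [wpsi] to the descent relation makes [psi + F] nonincreasing along the chain; as [F] is
   nonnegative, [psi] stays below the level that ensures [c <= w]. *)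
have psiu n : psi (u n) + F (u n) <= psi x0 + F x0.
  elim: n => // n; have := uS n; have := wpsi (u n) (u n.+1); rewrite /S.
  by lra.
have wu n : c <= w (u n) by apply: cw; have := psiu n; have := F0 (u n); lra.
have du n : c * `|u n.+1 - u n| <= F (u n) - F (u n.+1).
  have := uS n; rewrite /S.
  by have := ler_wpM2r (normr_ge0 (u n.+1 - u n)) (wu n); lra.
(* Telescoping with the constant [c] stands in for the missing transitivity. *)
have dun n k : c * `|u (n + k)%N - u n| <= F (u n) - F (u (n + k)%N).
  elim: k => [|k IH]; first by rewrite addn0 !subrr normr0 mulr0.
  rewrite addnS; have := du (n + k)%N.
  have := ler_wpM2l (ltW c0) (ler_distD (u (n + k)%N) (u (n + k).+1) (u n)).
  by rewrite mulrDr; lra.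
have Fu_decr : {homo (F \o u) : n m / (n <= m)%N >-> m <= n}.
  move=> n m /subnKC <- /=; have := dun n (m - n)%N.
  by have := mulr_ge0 (ltW c0) (normr_ge0 (u (n + (m - n))%N - u n)); lra.
have Fu_cvg : cvgn (F \o u).
  by apply: nonincreasing_is_cvgn => //; exists 0 => _ [n _ <-]; exact: F0.
pose l := limn (F \o u).
have lF n : l <= F (u n) by exact: (nonincreasing_cvgn_ge Fu_decr).
have /cvg_ex[z uz] : cvgn u.
  apply/cauchy_cvgP; apply: cauchy_exP => e e0.
  have [n _ Hn] : \forall n \near \oo, `|l - F (u n)| < c * e.
    have /cvgrPdist_lt := Fu_cvg; apply; exact: mulr_gt0.
  exists (u n); exists n => // m /= nm.
  have := Hn n (leqnn n); rewrite -(subnKC nm) -ball_normE /ball_/= distrC.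
  rewrite -(ltr_pM2l c0 _ e) ger0_norm ?subr_ge0 ?lF//.
  have := dun n (m - n)%N; have := lF (n + (m - n))%N.
  by move=> ? ?; rewrite distrC; lra.
have Fuz : F (u n) @[n --> \oo] --> F z by exact: cvg_comp uz (Fc z).
have Fz n : F z <= F (u n).
  by have := lF n; rewrite /l (cvg_lim _ Fuz).
have wuz : w (u n) @[n --> \oo] --> w z by exact: cvg_comp uz (wc z).
have duz x : `|x - u n| @[n --> \oo] --> `|x - z|.
  by apply: cvg_norm; apply: cvgB => //; exact: cvg_cst.
exists z; split.
- exact: (Fz 0%N).
(* The limit is taken in [wpsi (u n) z], whose right-hand side tends to 0, and not in [psi (u n)]
   itself. *)
- have : psi z - psi x0 - F x0 <= 0; last by lra.
  have H : w (u n) * `|z - u n| @[n --> \oo] --> (0 : R).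
    rewrite -(mulr0 (w z)) -(@normr0 _ X) -(subrr z).
    exact: cvgM.
  rewrite -(cvg_lim _ H)//; apply: limr_ge; first by apply/cvg_ex; exists 0.
  apply: nearW => n; have := wpsi (u n) z; have := psiu n.
  by have := F0 (u n); lra.
- move=> x; rewrite leNgt; apply/negP => Fx.
  have wz0 : 0 <= w z * `|x - z|.
    apply: mulr_ge0 => //; rewrite -(cvg_lim _ wuz)//; apply: limr_ge.
      by apply/cvg_ex; exists (w z).
    by apply: nearW => n; apply: le_trans (wu n); exact: ltW.
  (* A strict violation at [z] persists along the chain, so [x] competes in the choice of [u n.+1];
     in the limit the halfway rule forces [F z <= F x]. *)
  have Sn : \forall n \near \oo, S (u n) x.
    have : F x + w (u n) * `|x - u n| - F (u n) @[n --> \oo] -->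
       F x + w z * `|x - z| - F z.
      by apply: cvgB => //; apply: cvgD; [exact: cvg_cst|exact: cvgM].
    move=> /cvgr_le/(_ 0) H; near=> n; rewrite /S -subr_le0.
    by near: n; apply: H; lra.
  have : F z <= (F z + F x) / 2; last by lra.
  have H : (F (u n) + F x) / 2 @[n --> \oo] --> (F z + F x) / 2.
    by apply: cvgM; [apply: cvgD => //; exact: cvg_cst|exact: cvg_cst].
  rewrite -[leRHS](cvg_lim _ H)//; apply: limr_ge.
    by apply/cvg_ex; exists ((F z + F x) / 2).
  by apply: filterS Sn => n /gF; apply: le_trans; exact: (Fz n.+1).
Unshelve. all: by end_near.
Qed.

(** * Sublinear functionals and the Hahn-Banach theorem *)

Lemma le_infD (R : realType) (A B C : set R) :
  has_lbound A -> B !=set0 -> C !=set0 ->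
  (forall b c, B b -> C c -> exists2 a, A a & a <= b + c) ->
  inf A <= inf B + inf C.
Proof.
move=> lbA B0 C0 ABC; rewrite -lerBlDr; apply: lb_le_inf => // b Bb.
rewrite lerBlDr -lerBlDl; apply: lb_le_inf => // c Cc.
rewrite lerBlDl; have [a Aa] := ABC _ _ Bb Cc.
by apply: le_trans; exact: ge_inf.
Qed.

Lemma le_infZ (R : realType) (A B : set R) (t : R) :
  0 < t -> has_lbound A -> B !=set0 ->
  (forall b, B b -> exists2 a, A a & a <= t * b) -> inf A <= t * inf B.
Proof.
move=> t0 lbA B0 AB; rewrite -ler_pdivrMl//; apply: lb_le_inf => // b Bb.
rewrite ler_pdivrMl//; have [a Aa] := AB _ Bb.
by apply: le_trans; exact: ge_inf.
Qed.

Section sublinear.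
Variables (R : realType) (X : lmodType R).
Implicit Type p : X -> R.

(** Homogeneity is only an inequality, which is easier to check on infima; [sublinearZ] recovers
    equality by applying it to [t^-1]. *)
Definition sublinear p : Prop :=
  (forall u v, p (u + v) <= p u + p v) /\
  (forall t v, 0 < t -> p (t *: v) <= t * p v).

Lemma sublinearZ p t v : sublinear p -> 0 < t -> p (t *: v) = t * p v.
Proof.
move=> [_ pZ] t0; apply/eqP; rewrite eq_le pZ//=.
rewrite -ler_pdivlMl//; apply: le_trans (pZ _ _ _); last by rewrite invr_gt0.
by rewrite scalerA mulVf ?scale1r// gt_eqF.
Qed.

Lemma sublinear0 p : sublinear p -> p 0 = 0.
Proof.
by move=> /(@sublinearZ p 2 0); rewrite scaler0 => /(_ (ltr0n _ 2)); lra.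
Qed.

Lemma sublinearN p v : sublinear p -> - p (- v) <= p v.
Proof.
by move=> sp; have := sp.1 v (- v); rewrite subrr (sublinear0 sp); lra.
Qed.

(** The infimum of a nonempty chain is finite, by the lower bound [- p (- v)], and subadditive,
    since the smaller of two members serves both arguments. *)
Lemma minimal_sublinear p : sublinear p ->
  exists q, [/\ sublinear q, forall v, q v <= p v &
    forall r, sublinear r -> (forall v, r v <= q v) -> r = q].
Proof.
move=> sp; pose T := {q : X -> R | sublinear q /\ forall v, q v <= p v}.
(* The order is reversed, so that a Zorn-maximal element is pointwise minimal. *)
pose le (q r : T) := `[< forall v, sval r v <= sval q v >].
have [|||A Atot|q qmin] := @Zorn T le.
- by move=> q; apply/asboolP.
- move=> q r s /asboolP qr /asboolP rs; apply/asboolP => v.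
  exact: le_trans (rs v) (qr v).
- move=> [q Pq] [r Pr] /asboolP/= qr /asboolP/= rq; apply: eq_exist.
  by apply/funext => v; apply/eqP; rewrite eq_le rq qr.
- have [[q0 Aq0]|A0] := pselect (A !=set0); last first.
    exists (exist _ p (conj sp (fun=> lexx _))) => q Aq.
    by case: A0; exists q.
  pose B v := [set sval q v | q in A].
  have lbB v : has_lbound (B v).
    exists (- p (- v)) => _ [[q [sq qp]] Aq <-] /=.
    by have := sublinearN v sq; have := qp (- v); lra.
  have B0 v : B v !=set0 by exists (sval q0 v), q0.
  pose m v := inf (B v).
  have mle (q : T) v : A q -> m v <= sval q v.
    by move=> Aq; apply: ge_inf => //; exists q.
  have sm : sublinear m.
    split=> [u v|t v t0].
      apply: le_infD => // _ _ [q Aq <-] [r Ar <-].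
      have [/asboolP qr|/asboolP rq] := Atot q r Aq Ar.
        exists (sval r (u + v)); first by exists r.
        by have := (svalP r).1.1 u v; have := qr u; lra.
      exists (sval q (u + v)); first by exists q.
      by have := (svalP q).1.1 u v; have := rq v; lra.
    apply: le_infZ => // _ [q Aq <-]; exists (sval q (t *: v)).
      by exists q.
    exact: (svalP q).1.2.
  have mp v : m v <= p v by apply: le_trans (mle q0 v Aq0) ((svalP q0).2 v).
  by exists (exist _ m (conj sm mp)) => q Aq; apply/asboolP => v; exact: mle.
exists (sval q); split; [exact: (svalP q).1|exact: (svalP q).2|].
move=> r sr rq; have rp v : r v <= p v := le_trans (rq v) ((svalP q).2 v).
have /qmin <- // : le q (exist _ r (conj sr rp)) by apply/asboolP.
Qed.

(** The infimum [r v] of [q (v + t x) - t q x] over [t >= 0] is sublinear and below [q], hence equal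
    to [q]; the member at [t = 1] then gives superadditivity. *)
Lemma minimal_sublinearD (q : X -> R) : sublinear q ->
    (forall r, sublinear r -> (forall v, r v <= q v) -> r = q) ->
  forall u v, q (u + v) = q u + q v.
Proof.
move=> sq qmin u x.
apply/eqP; rewrite eq_le sq.1/=.
pose A v := [set q (v + t *: x) - t * q x | t in [set t | 0 <= t]].
have A0 v : A v !=set0 by exists (q (v + 0 *: x) - 0 * q x), 0 => /=.
have lbA v : has_lbound (A v).
  exists (- q (- v)) => _ [t /= t0 <-].
  have : t * q x <= q (v + t *: x) + q (- v).
    apply: le_trans (sq.1 _ _); rewrite addrAC subrr add0r.
    move: t0; rewrite le_eqVlt => /predU1P[<-|t0]; last by rewrite sublinearZ.
    by rewrite scale0r mul0r sublinear0.
  by lra.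
pose r v := inf (A v).
have rle v t : 0 <= t -> r v <= q (v + t *: x) - t * q x.
  by move=> t0; apply: ge_inf => //; exists t.
have rq : r = q.
  apply: qmin => [|v]; last first.
    by have := rle v 0 (lexx _); rewrite scale0r addr0; lra.
  split=> [v v'|s v s0].
    apply: le_infD => // _ _ [t /= t0 <-] [t' /= t'0 <-].
    exists (q (v + v' + (t + t') *: x) - (t + t') * q x).
      by exists (t + t') => //=; exact: addr_ge0.
    have := sq.1 (v + t *: x) (v' + t' *: x).
    by rewrite addrACA -scalerDl; lra.
  apply: le_infZ => // _ [t /= t0 <-].
  exists (q (s *: v + (s * t) *: x) - (s * t) * q x).
    by exists (s * t) => //=; rewrite mulr_ge0 ?(ltW s0).
  by rewrite -scalerA -scalerDr mulrBr (sublinearZ _ sq)// mulrA.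
have := rle u 1 ler01; rewrite rq scale1r; lra.
Qed.

(* Zorn on sublinear functionals rather than on partial extensions: a pointwise
   minimal one is additive, hence linear. *)
Theorem hahn_banach p : sublinear p ->
  exists w : {linear X -> R^o}, forall v, w v <= p v.
Proof.
move=> sp; have [q [sq qp qmin]] := minimal_sublinear sp.
have qD := minimal_sublinearD sq qmin.
have qN v : q (- v) = - q v.
  by have := qD v (- v); rewrite subrr (sublinear0 sq); lra.
have ql : linear (q : X -> R^o).
  move=> t u v; rewrite qD; congr (_ + _).
  have [t0|t0|->] := ltgtP t 0; last 2 first.
  - exact: sublinearZ.
  - by rewrite !scale0r (sublinear0 sq).
  by rewrite -[t]opprK scaleNr qN (sublinearZ _ sq) ?oppr_gt0// scaleNr.
pose w : {linear X -> R^o} :=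
  HB.pack (q : X -> R^o) (GRing.isLinear.Build R X R^o _ q ql).
by exists w => v; exact: qp.
Qed.

End sublinear.

(** * An upper bound for [clarke_lambda] from a slope condition *)

Lemma cvg_diff_quotient (R : realType) (X Y : normedModType R) (f : X -> Y)
    (z v : X) : differentiable f z ->
  t^-1 *: (f (z + t *: v) - f z) @[t --> (0 : R)^'+] --> 'd f z v.
Proof.
move=> df; have : derivable f z v by exact: diff_derivable.
rewrite /derivable -/(derive f z v) (deriveE v df).
move=> /cvg_dnbhs_at_right; apply: cvg_trans; apply: near_eq_cvg.
by apply: nearW => t; rewrite /= (addrC z).
Qed.

(* [w] is Hahn-Banach applied to the infimal convolution of [k * `|.|] with the
   sublinear hull [v |-> inf_r r * C (v / r)] of [C]. *)
Theorem sandwich (R : realType) (X : normedModType R) (C : X -> R) (k : R) :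
  0 <= k -> C 0 = 0 ->
  (forall s t u v, 0 < s -> 0 < t -> s + t = 1 ->
    C (s *: u + t *: v) <= s * C u + t * C v) ->
  (forall v, - (k * `|v|) <= C v) ->
  exists w : {linear X -> R^o},
    (forall v, (w v : R) <= C v) /\ (forall v, `|w v : R| <= k * `|v|).
Proof.
move=> k0 C0 Cconv Ck.
pose A v := [set ru.1 * C ru.2 + k * `|v - ru.1 *: ru.2|
            | ru in [set ru : R * X | 0 < ru.1]].
have memA v r u : 0 < r -> A v (r * C u + k * `|v - r *: u|).
  by move=> r0; exists (r, u).
have A0 v : A v !=set0.
  by exists (1 * C 0 + k * `|v - 1 *: 0|); exact: memA.
have lbA v : has_lbound (A v).
  exists (- (k * `|v|)) => _ [[r u] /= r0 <-].
  have := ler_wpM2l (ltW r0) (Ck u).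
  have := ler_wpM2l k0 (ler_normB v (v - r *: u)).
  have -> : v - (v - r *: u) = r *: u by rewrite opprB addrC subrK.
  by rewrite normrZ (gtr0_norm r0); lra.
pose p v := inf (A v).
have ple v r u : 0 < r -> p v <= r * C u + k * `|v - r *: u|.
  by move=> r0; apply: ge_inf => //; exact: memA.
have sp : sublinear p.
  split=> [v v'|t v t0]; last first.
    apply: le_infZ => // _ [[r u] /= r0 <-].
    exists ((t * r) * C u + k * `|t *: v - (t * r) *: u|).
      by apply: memA; exact: mulr_gt0.
    by rewrite -scalerA -scalerBr normrZ (gtr0_norm t0); lra.
  apply: le_infD => // _ _ [[r u] /= r0 <-] [[r' u'] /= r'0 <-].
  have rr0 : 0 < r + r' by exact: addr_gt0.
  have rrN0 : r + r' != 0 by rewrite gt_eqF.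
  (* By convexity of [C], these weights merge [r * C u + r' * C u'] into a single term of the hull
     with factor [r + r']. *)
  pose s := r / (r + r'); pose s' := r' / (r + r').
  have rs : (r + r') * s = r by rewrite mulrC divfK.
  have rs' : (r + r') * s' = r' by rewrite mulrC divfK.
  exists ((r + r') * C (s *: u + s' *: u') +
          k * `|v + v' - (r + r') *: (s *: u + s' *: u')|).
    exact: memA.
  have -> : (r + r') *: (s *: u + s' *: u') = r *: u + r' *: u'.
    by rewrite scalerDr !scalerA rs rs'.
  have -> : v + v' - (r *: u + r' *: u') = (v - r *: u) + (v' - r' *: u').
    by rewrite opprD addrACA.
  have := ler_wpM2l k0 (ler_normD (v - r *: u) (v' - r' *: u')).
  have : C (s *: u + s' *: u') <= s * C u + s' * C u'.
    by apply: Cconv; rewrite ?divr_gt0// -mulrDl divff.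
  move=> /(ler_wpM2l (ltW rr0)).
  by rewrite (mulrDr (r + r')) 2!(mulrA (r + r')) rs rs'; lra.
have [w wp] := hahn_banach sp.
have wk v : (w v : R) <= k * `|v|.
  apply: le_trans (wp v) _; apply: le_trans (ple v 1 0 ltr01) _.
  by rewrite C0 mulr0 add0r scaler0 subr0.
exists w; split=> v.
  apply: le_trans (wp v) _; apply: le_trans (ple v 1 v ltr01) _.
  by rewrite scale1r subrr normr0 mulr0 addr0 mul1r.
rewrite ler_norml wk andbT lerNl.
by have := wk (- v); rewrite linearN normrN.
Qed.

Lemma half_sqr_norm_convex (R : realType) (Y : normedModType R) (s t : R)
    (b c : Y) : 0 < s -> 0 < t -> s + t = 1 ->
  2^-1 * `|s *: b + t *: c| ^+ 2 <=
  s * (2^-1 * `|b| ^+ 2) + t * (2^-1 * `|c| ^+ 2).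
Proof.
move=> s0 t0 st1.
have : `|s *: b + t *: c| ^+ 2 <= (s * `|b| + t * `|c|) ^+ 2.
  rewrite ler_sqr ?nnegrE ?addr_ge0 ?mulr_ge0 ?(ltW s0) ?(ltW t0)//.
  by apply: le_trans (ler_normD _ _) _; rewrite !normrZ !gtr0_norm.
(* Since [s + t = 1], this is [s |b|^2 + t |c|^2 - (s |b| + t |c|)^2]. *)
have : 0 <= s * t * (`|b| - `|c|) ^+ 2.
  by rewrite mulr_ge0 ?sqr_ge0// mulr_ge0// ltW.
have -> : t = 1 - s by lra.
by move=> ? ?; nra.
Qed.

(** Only [f] is linearized, since the norm of [Y] may fail to be differentiable. The difference of
    half squares factors, and its small factor is at most [t] times the error of the difference
    quotient. *)
Lemma half_sq_dist_diff (R : realType) (X Y : normedModType R) (f : X -> Y)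
    (y : Y) (z v : X) (e : R) : differentiable f z -> 0 < e ->
  \forall t \near (0 : R)^'+,
    `|half_sq_dist f y (z + t *: v) -
      2^-1 * `|(f z - y) + t *: 'd f z v| ^+ 2| <= e * t.
Proof.
move=> df e0; set a := f z - y; set l := 'd f z v.
pose c t := t^-1 *: (f (z + t *: v) - f z).
have cl : c t @[t --> (0 : R)^'+] --> l by exact: cvg_diff_quotient.
have tc (g : R -> Y) (m : Y) : g t @[t --> (0 : R)^'+] --> m ->
    `|a + t *: g t| @[t --> (0 : R)^'+] --> `|a|.
  move=> gm; have -> : `|a| = `|a + 0 *: m| by rewrite scale0r addr0.
  apply: cvg_norm; apply: cvgD; first exact: cvg_cst.
  by apply: cvgZ => //; exact: cvg_within_filter cvg_id.
have : 2^-1 * (`|a + t *: c t| + `|a + t *: l|) * `|c t - l|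
    @[t --> (0 : R)^'+] --> 2^-1 * (`|a| + `|a|) * `|l - l|.
  apply: cvgM; last by apply: cvg_norm; apply: cvgB => //; exact: cvg_cst.
  apply: cvgM; first exact: cvg_cst.
  by apply: cvgD; [exact: tc cl|exact: (tc (cst l) _ (cvg_cst _))].
rewrite subrr normr0 mulr0 => /cvgr_le/(_ _ e0) ce.
near=> t.
have t0 : 0 < t by near: t; exact: nbhs_right_gt.
have ce' : 2^-1 * (`|a + t *: c t| + `|a + t *: l|) * `|c t - l| <= e.
  by near: t.
have -> : half_sq_dist f y (z + t *: v) = 2^-1 * `|a + t *: c t| ^+ 2.
  rewrite /half_sq_dist /c scalerA divff ?gt_eqF// scale1r /a.
  by congr (_ * `|_| ^+ 2); rewrite [RHS]addrC addrA subrK.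
set b := a + t *: c t; set b' := a + t *: l.
have bb' : `| `|b| - `|b'| | <= t * `|c t - l|.
  apply: le_trans (ler_dist_dist _ _) _.
  by rewrite /b /b' opprD addrACA subrr add0r -scalerBr normrZ gtr0_norm.
have -> : 2^-1 * `|b| ^+ 2 - 2^-1 * `|b'| ^+ 2 =
    2^-1 * (`|b| + `|b'|) * (`|b| - `|b'|) by ring.
have bb0 : 0 <= 2^-1 * (`|b| + `|b'|) by rewrite mulr_ge0 ?addr_ge0.
rewrite normrM (ger0_norm bb0); apply: le_trans (ler_wpM2l bb0 bb') _.
by rewrite mulrCA mulrC ler_pM2r.
Unshelve. all: by end_near.
Qed.

Lemma opnorm_ge0 (R : realType) (V W : normedModType R) (g : V -> W) :
  0 <= opnorm g.
Proof.
rewrite /opnorm; set A := (X in sup X).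
(* Without a supremum, [sup] takes the default value 0. *)
have [[_ ubA]|nA] := pselect (has_sup A); last by rewrite sup_out.
apply: (le_trans (normr_ge0 (g 0))); apply: ub_le_sup => //.
by exists 0; rewrite //= normr0.
Qed.

(** The convex model [C] agrees with [F (z + v) - F z] to first order along rays, so it inherits the
    slope bound [k]; the functional that [sandwich] puts below [C] lies in the Clarke gradient and
    has norm at most [k]. *)
Lemma clarke_lambda_le (R : realType) (X Y : normedModType R) (f : X -> Y)
    (y : Y) (z : X) (k : R) : differentiable f z -> 0 <= k ->
  (forall x, half_sq_dist f y z - k * `|x - z| <= half_sq_dist f y x) ->
  clarke_lambda (half_sq_dist f y) z <= k.
Proof.
move=> df k0 Fk; set F := half_sq_dist f y in Fk *.
pose a := f z - y; pose phi (b : Y) : R := 2^-1 * `|b| ^+ 2.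
pose C v := phi (a + 'd f z v) - phi a.
have C0 : C 0 = 0 by rewrite /C linear0 addr0 subrr.
have Cconv s t u v : 0 < s -> 0 < t -> s + t = 1 ->
    C (s *: u + t *: v) <= s * C u + t * C v.
  move=> s0 t0 st1; rewrite /C; have -> : a + 'd f z (s *: u + t *: v) =
      s *: (a + 'd f z u) + t *: (a + 'd f z v).
    rewrite linearD !linearZ/= 2!(scalerDr _ a) [RHS]addrACA.
    by rewrite -scalerDl st1 scale1r.
  have := half_sqr_norm_convex (a + 'd f z u) (a + 'd f z v) s0 t0 st1.
  rewrite -!/(phi _).
  have -> : t = 1 - s by lra.
  by lra.
have CF v e : 0 < e -> \forall t \near (0 : R)^'+,
    `|F (z + t *: v) - F z - C (t *: v)| <= e * t.
  move=> e0; apply: filterS (half_sq_dist_diff y v df e0) => t.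
  apply: le_trans; rewrite le_eqVlt; apply/predU1P; left; congr (`|_|).
  have Lt : 'd f z (t *: v) = t *: 'd f z v by rewrite linearZ.
  by rewrite (_ : F z = phi a)// /C Lt /phi -/a -/F; ring.
have Ck v : - (k * `|v|) <= C v.
  apply/ler_addgt0Pr => e e0; near (0 : R)^'+ => t.
  have t0 : 0 < t by near: t; exact: nbhs_right_gt.
  have t1 : t < 1 by near: t; exact: nbhs_right_lt.
  have : `|F (z + t *: v) - F z - C (t *: v)| <= e * t by near: t; exact: CF.
  rewrite ler_norml => /andP[_ Ct].
  have := Fk (z + t *: v); rewrite [_ - z]addrAC subrr add0r normrZ.
  rewrite (gtr0_norm t0) => Ft.
  (* Convexity and [C 0 = 0] carry the bound from small [t] back to [v] itself. *)
  have Cvt : C (t *: v) <= t * C v.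
    have := @Cconv t (1 - t) v 0; rewrite scaler0 addr0 C0 mulr0 addr0.
    by apply; lra.
  by rewrite -(ler_pM2l t0); lra.
have [w [wC wk]] := sandwich k0 C0 Cconv Ck.
have wgrad : clarke_gradient F z w.
  split.
    apply: bounded_linear_continuous; apply/linear_boundedP.
    exists k; split; first exact: ger0_real.
    by move=> r kr v; apply: le_trans (wk v) _; rewrite ler_wpM2r// ltW.
  move=> v; apply/lee_addgt0Pr => e e0.
  rewrite -leeBlDr//.
  (* Every set of the filter contains [(0, t)] for small [t > 0], so testing at [z] itself already
     bounds the upper limit from below. *)
  apply: le_ereal_inf_tmp => _ [V [[P Q] /= [P0 Q0] PQV] <-].
  near (0 : R)^'+ => t.
  have t0 : 0 < t by near: t; exact: nbhs_right_gt.
  have : `|F (z + t *: v) - F z - C (t *: v)| <= e * t by near: t; exact: CF.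
  rewrite ler_norml => /andP[Ct _].
  apply: le_ereal_sup_tmp; exists (t^-1 * (F (z + t *: v) - F z))%:E.
    exists (0, t); last by rewrite /= addr0.
    by apply: PQV; split => /=; [exact: nbhs_singleton|near: t].
  rewrite -EFinB lee_fin ler_pdivlMl//.
  by have := wC (t *: v); rewrite linearZ/= /GRing.scale/=; lra.
apply: le_trans (_ : opnorm w <= k).
  apply: ge_inf; last by exists w.
  by exists 0 => _ [g _ <-]; exact: opnorm_ge0.
apply: ge_sup; first by exists `|w 0|, 0; rewrite //= normr0.
move=> _ [v /= v1 <-]; apply: le_trans (wk v) _.
by rewrite -[leRHS]mulr1 ler_wpM2l.
Unshelve. all: by end_near.
Qed.

Lemma clarke_lambda_ge0 (R : realType) (X : normedModType R) (F : X -> R)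
    (x : X) : 0 <= clarke_lambda F x.
Proof.
have [[g xg]|E0] := pselect (clarke_gradient F x !=set0).
  by apply: lb_le_inf => [|_ [g' _ <-]]; [exists (opnorm g), g|
                                          exact: opnorm_ge0].
rewrite /clarke_lambda (_ : clarke_gradient F x = set0) ?image_set0 ?inf0//.
by apply/eqP/negPn/negP => /set0P.
Qed.

(** * Local surjectivity from approximate preimages *)

(** By Baire some [B n] contains a ball around a point [y0]. Subtracting approximate preimages of
    [y0] and [y0 + s r] and rescaling gives one of [r]. *)
Lemma approx_surjective (R : realType) (X : normedModType R)
    (Y : completeNormedModType R) (L : {linear X -> Y}) :
  (forall y, exists x, L x = y) ->
  exists2 K, 0 < K & forall r, exists2 a, `|a| <= K * `|r| &
                                          `|L a - r| <= `|r| / 4.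
Proof.
move=> Lsurj; pose B (n : nat) := closure (L @` [set x | `|x| <= n%:R]).
have [n nB] : exists n, ~ dense (~` B n).
  apply/existsNP => dB.
  have /(_ setT)[||y [_ yB]] : dense (\bigcap_n ~` B n).
  - apply: Baire => n; split; last exact: dB.
    by apply: closed_openC; exact: closed_closure.
  - by exists 0.
  - exact: openT.
  have [x xy] := Lsurj y; have /= := yB (Num.truncn `|x|).+1 I; apply.
  by apply: subset_closure; exists x => //=; exact/ltW/truncnS_gt.
have [U [[y0 [oU Uy0]] UB]] := denseNE nB.
have {}UB y : U y -> B n y.
  by move=> Uy; apply: contrapT => nBy; suff : set0 y by []; rewrite -UB.
have /nbhs_ballP[d /= d0 dU] : nbhs y0 U by exact: open_nbhs_nbhs.
have BP y : ball y0 d y -> exists2 x, `|x| <= n%:R & `|L x - y| < d / 16.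
  move=> /dU/UB /(_ (ball y (d / 16)))[].
    by apply: nbhsx_ballx; rewrite divr_gt0.
  move=> _ [[x xn <-]]; rewrite -ball_normE /= distrC.
  by exists x.
have [x0 x0n x0y] := BP y0 (ballxx y0 d0).
(* The difference has norm at most [2 n] and is divided by [s = d / (2 |r|)], whence [4 n / d]; the
   [1] keeps [K] positive when [n = 0]. Two errors [d / 16] become [|r| / 4]. *)
exists (4 * n%:R / d + 1) => [|r].
  by rewrite ltr_wpDl// divr_ge0 ?mulr_ge0// ltW.
have [->|r0] := eqVneq r 0.
  by exists 0; [rewrite !normr0 mulr0|rewrite linear0 subr0 normr0 mul0r].
have nr0 : 0 < `|r| by rewrite normr_gt0.
pose s := d / 2 / `|r|.
have s0 : 0 < s by rewrite divr_gt0// divr_gt0.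
have sr : s * `|r| = d / 2 by rewrite divfK// gt_eqF.
have [|x1 x1n x1y] := BP (y0 + s *: r).
  rewrite -ball_normE /= opprD addNKr normrN normrZ (gtr0_norm s0) sr.
  lra.
have sV : s^-1 = 2 * `|r| / d.
  by rewrite /s; field; rewrite ?gt_eqF//.
exists (s^-1 *: (x1 - x0)).
  rewrite normrZ gtr0_norm ?invr_gt0// ler_pdivrMl//.
  apply: le_trans (ler_normB _ _) _.
  rewrite mulrCA sr.
  have -> : (4 * n%:R / d + 1) * (d / 2) = 2 * n%:R + d / 2.
    by field; rewrite gt_eqF.
  by lra.
rewrite linearZ linearB /=.
have -> : s^-1 *: (L x1 - L x0) - r =
    s^-1 *: ((L x1 - (y0 + s *: r)) - (L x0 - y0)).
  rewrite -[X in _ - X = _]scale1r -(mulVf (lt0r_neq0 s0)) -scalerA -scalerBr.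
  congr (_ *: _); rewrite opprB (addrA _ y0) opprD (addrA (L x1)).
  by rewrite [L x1 - y0 - _ + y0]addrAC subrK addrAC.
rewrite normrZ gtr0_norm ?invr_gt0// ler_pdivrMl//.
apply: le_trans (ler_normB _ _) _; rewrite mulrA sr.
by lra.
Qed.

Lemma le_opnorm (R : realType) (V W : normedModType R) (g : {linear V -> W}) v :
  continuous g -> `|g v| <= opnorm g * `|v|.
Proof.
move=> gc; have [M [_ gM]] :=
  (linear_boundedP g).1 (continuous_linear_bounded 0 (gc 0)).
have ubA : has_ubound [set `|g v| | v in [set v : V | `|v| <= 1]].
  exists (`|M| + 1) => _ [u /= u1 <-].
  apply: le_trans (gM (`|M| + 1) _ u) _.
    by rewrite ltr_pwDr// ler_norm.
  by rewrite -[leRHS]mulr1 ler_wpM2l// addr_ge0.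
have [->|v0] := eqVneq v 0; first by rewrite linear0 !normr0 mulr0.
have nv0 : 0 < `|v| by rewrite normr_gt0.
rewrite -ler_pdivrMr//; apply: ub_le_sup => //.
exists (`|v|^-1 *: v).
  by rewrite /= normrZ normfV normr_id mulVf// gt_eqF.
by rewrite linearZ/= normrZ normfV normr_id mulrC.
Qed.

(** At the Ekeland point, a step along an approximate preimage [a] of a nonzero residual
    [r = y - f z] would decrease the distance at rate at least [3/8 |r|], more than the allowed
    [e |a| <= |r| / 4]. *)
Lemma local_surjection (R : realType) (X Y : completeNormedModType R)
    (f : X -> Y) (x0 : X) : local_C1_diffeomorphism f ->
  exists2 d, 0 < d & forall y, `|f x0 - y| < d -> exists x, f x = y.
Proof.
move=> [[fd fC1] fbij].
have [|K K0 HK] := @approx_surjective R X Y ('d f x0).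
  by move=> y; have [g _ gK] := fbij x0; exists (g y).
pose e := (4 * K)^-1.
have e0 : 0 < e by rewrite invr_gt0 mulr_gt0.
have eK : e * K = 1 / 4 by rewrite /e; field; rewrite gt_eqF.
have /nbhs_ballP[d /= d0 dball] :
    \forall z \near x0, opnorm ('d f z \- 'd f x0) <= e.
  by have /cvgr_le := fC1 x0; apply.
(* The potential [e |x - x0|] yields [e |z - x0| <= |f x0 - y| < e d], which keeps [z] where the
   derivative is within [e] of ['d f x0]. *)
exists (e * d) => [|y fy]; first exact: mulr_gt0.
have fcont : continuous f by move=> x; exact: differentiable_continuous.
have [| | | | | |z [_ zx0 zmin]] := @weighted_ekeland R X (fun x => `|f x - y|)
  (cst e) (fun x => e * `|x - x0|) e x0.
- move=> x; apply: cvg_norm; apply: cvgB; [exact: fcont|exact: cvg_cst].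
- by [].
- by move=> x; exact: cvg_cst.
- move=> u v /=; rewrite -mulrBr ler_pM2l// lerBlDr.
  exact: ler_distD.
- by [].
- by [].
have zd : ball x0 d z.
  rewrite -ball_normE /= distrC -(ltr_pM2l e0).
  by apply: le_lt_trans fy; move: zx0; rewrite subrr normr0 mulr0 add0r.
have opz : opnorm ('d f z \- 'd f x0) <= e by exact: dball zd.
exists z; apply/eqP; rewrite -subr_eq0 -normr_le0 leNgt; apply/negP.
pose r := y - f z; rewrite distrC -/r => r0.
have [a aK aL] := HK r.
have dfa : `|'d f z a - r| <= `|r| / 2.
  have := @le_opnorm R X Y ('d f z \- 'd f x0) a.
  have ctg : continuous ('d f z \- 'd f x0).
    move=> x; apply: cvgB; exact: diff_continuous.
  move=> /(_ ctg) /= H.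
  have := ler_distD ('d f x0 a) ('d f z a) r.
  have := ler_wpM2r (normr_ge0 a) opz.
  have := ler_wpM2l (ltW e0) aK; rewrite mulrA eK.
  by lra.
have H1 : `|t^-1 *: (f (z + t *: a) - f z) - r| @[t --> (0 : R)^'+] -->
    `|'d f z a - r|.
  by apply: cvg_norm; apply: cvgB; [exact: cvg_diff_quotient|exact: cvg_cst].
near (0 : R)^'+ => t.
have t0 : 0 < t by near: t; exact: nbhs_right_gt.
have t1 : t < 1 by near: t; exact: nbhs_right_lt.
(* Any factor strictly between [1/2], from [dfa], and [3/4 = 1 - e K] works. *)
have ct : `|t^-1 *: (f (z + t *: a) - f z) - r| <= `|r| * (5 / 8).
  near: t; move/cvgr_le : H1; apply; lra.
have := zmin (z + t *: a); rewrite /= [_ - z]addrAC subrr add0r normrZ.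
rewrite (gtr0_norm t0) (distrC (f z)) -/r.
have -> : f (z + t *: a) - y =
    t *: (t^-1 *: (f (z + t *: a) - f z) - r) - (1 - t) *: r.
  rewrite scalerBr scalerA divff ?gt_eqF// scale1r scalerBl scale1r opprB.
  by rewrite addrA subrK /r opprB addrA subrK.
have := ler_normB (t *: (t^-1 *: (f (z + t *: a) - f z) - r)) ((1 - t) *: r).
rewrite !normrZ (gtr0_norm t0) (@gtr0_norm _ (1 - t)) ?subr_gt0//.
have := ler_wpM2l (ltW t0) ct.
have := ler_wpM2l (ltW t0) (ler_wpM2l (ltW e0) aK); rewrite (mulrA e) eK.
have := mulr_gt0 t0 r0.
by lra.
Unshelve. all: by end_near.
Qed.

(** * The concave potential and closedness of the range *)

(** [Phi] is the integral of [1 / (1 + h)] from 0. As the integrand is nonincreasing, comparison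
    with constants gives the supergradient inequality on both sides of [r]; monotone convergence on
    [[0, n + 1]] makes [Phi] unbounded. *)
Lemma concave_potential (R : realType) (h : R -> R) :
  (forall r, 0 <= r -> 0 <= h r) ->
  {within `[0, +oo[, continuous h} ->
  {in `[0, +oo[ &, {homo h : r s / r <= s}} ->
  (\int[lebesgue_measure]_(rho in `[0%R, +oo[) ((1 + h rho)^-1)%:E = +oo)%E ->
  exists2 Phi : R -> R,
    forall r s, 0 <= r -> 0 <= s -> Phi s - Phi r <= (1 + h r)^-1 * (s - r) &
    forall M, exists2 r, 0 <= r & M < Phi r.
Proof.
move=> h0 hc hmono hint; pose g (r : R) := (1 + h r)^-1.
have h1 r : 0 <= r -> 0 < 1 + h r by move=> /h0; lra.
have g0 r : 0 <= r -> 0 < g r by move=> /h1; rewrite invr_gt0.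
have gmono r s : 0 <= r -> r <= s -> g s <= g r.
  move=> r0 rs; have s0 := le_trans r0 rs.
  rewrite /g lef_pV2 ?posrE ?h1// lerD2l.
  by apply: hmono; rewrite // in_itv/= andbT.
have gc : {within `[0, +oo[, continuous g}.
  apply/subspace_continuousP => r; rewrite /= in_itv/= andbT => r0.
  apply: cvgV; first by rewrite gt_eqF// h1.
  apply: cvgD; first exact: cvg_cst.
  move/subspace_continuousP : hc; apply.
  by rewrite /= in_itv/= andbT.
have gcI a b : 0 <= a -> {within `[a, b], continuous g}.
  move=> a0; apply: continuous_subspaceW gc => x /=.
  by rewrite !in_itv/= andbT => /andP[ax _]; exact: le_trans ax.
have gint a b : 0 <= a ->
    lebesgue_measure.-integrable `[a, b] (EFin \o g).
  move=> a0; apply: continuous_compact_integrable; first exact: segment_compact.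
  exact: gcI.
pose Phi r := \int[lebesgue_measure]_(t in `[0, r]) g t.
have PhiB r s : 0 <= r -> r <= s ->
    g s * (s - r) <= Phi s - Phi r <= g r * (s - r).
  move=> r0 rs; have s0 := le_trans r0 rs.
  have iS : lebesgue_measure.-integrable `]r, s] (EFin \o g).
    apply: integrableS (gint r s r0) => //.
    by apply: subset_itvr; rewrite bnd_simp.
  have icst (c : R) : lebesgue_measure.-integrable `]r, s] (EFin \o cst c).
    apply: integrableS (_ : lebesgue_measure.-integrable `[r, s] _) => //.
      by apply: subset_itvr; rewrite bnd_simp.
    apply: continuous_compact_integrable; first exact: segment_compact.
    by apply: continuous_subspaceT => x; exact: cvg_cst.
  have mrs : fine (lebesgue_measure (`]r, s] : set R)) = s - r.
    rewrite lebesgue_measure_itv/= lte_fin.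
    by move: rs; rewrite le_eqVlt => /predU1P[->|->//]; rewrite ltxx subrr.
  rewrite /Phi Rintegral_itvB ?bnd_simp//; last exact: gint.
  rewrite -mrs -!(Rintegral_cst lebesgue_measure)//.
  apply/andP; split; (apply: le_Rintegral => //; first exact: icst) => x /=;
    rewrite in_itv/= => /andP[rx xs]; apply: gmono => //.
    by apply: le_trans r0 _; exact: ltW.
  exact: ltW.
exists Phi => [r s r0 s0|M].
  have [rs|/ltW sr] := leP r s; first by have /andP[] := PhiB r s r0 rs.
  by have /andP[+ _] := PhiB s r s0 sr; rewrite /g; lra.
apply: contrapT => PhiM.
have {}PhiM n : Phi n.+1%:R <= M.
  by rewrite leNgt; apply/negP => MPhi; apply: PhiM; exists n.+1%:R.
have : (\int[lebesgue_measure]_(t in `[0%R, n.+1%:R]) (g t)%:E)%E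
    @[n --> \oo] --> +oo%E.
  rewrite -hint itv0y_bigcup0S.
  apply: (@ge0_nondecreasing_set_cvg_integral _ (measurableTypeR R) R
    (fun n => `[0%R, n.+1%:R]%classic) (EFin \o g) lebesgue_measure).
  - move=> n m nm; apply/subsetPset => x /=; rewrite !in_itv/= => /andP[->] /=.
    by move=> /le_trans; apply; rewrite ler_nat.
  - by [].
  - by move=> n; exact: (measurable_int lebesgue_measure (gint _ _ (lexx 0))).
  - move=> n x /=; rewrite in_itv/= lee_fin => /andP[x0 _]; exact/ltW/g0.
move=> limy; suff : (+oo <= M%:E)%E by [].
rewrite -(cvg_lim _ limy)//; apply: lime_le.
  by apply/cvg_ex; exists +oo%E.
apply: nearW => n; rewrite -[leLHS]fineK ?lee_fin; first exact: PhiM.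
exact: (integrable_fin_num _ (gint _ _ (lexx 0))).
Qed.

(** On the segment from a point of [A] to [y], the preimage of [A] is nonempty, open and closed in
    [[0, 1]]. *)
Lemma connected_range (R : realType) (Y : normedModType R) (A : set Y) :
  A !=set0 -> open A -> closed A -> A = setT.
Proof.
move=> [a Aa] oA cA; apply/seteqP; split=> // y _.
pose g (t : R) : Y := a + t *: (y - a).
have gc : continuous g.
  move=> t; apply: cvgD; first exact: cvg_cst.
  by apply: cvgZ => //; exact: cvg_cst.
have : `[0, 1] `&` g @^-1` A = `[0, 1]%classic.
  apply: (@segment_connected R 0 1).
  - by exists 0; split; rewrite /= ?in_itv/= ?lexx ?ler01// /g scale0r addr0.
  - by exists (g @^-1` A) => //; exact: open_comp.
  - by exists (g @^-1` A) => //; exact: closed_comp.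
move=> /seteqP[_ /(_ 1)] []; first by rewrite /= in_itv/= ler01 lexx.
by move=> _; rewrite /= /g scale1r addrC subrK.
Qed.

Lemma continuous_weight (R : realType) (X : normedModType R) (h : R -> R) :
  (forall r, 0 <= r -> 0 <= h r) -> {within `[0, +oo[, continuous h} ->
  continuous (fun x : X => (1 + h `|x|)^-1).
Proof.
move=> h0 hc x; apply: cvgV; first by rewrite gt_eqF// ltr_wpDr ?h0.
apply: cvgD; first exact: cvg_cst.
have H : h r @[r --> within `[0, +oo[ (nbhs `|x|)] --> h `|x|.
  by move/subspace_continuousP : hc; apply; rewrite /= in_itv/= andbT.
(* [h] is continuous only within the half-line, where every norm lies. *)
apply: (cvg_comp _ _ _ H) => A /(norm_continuous (x := x)); rewrite /nbhs /=.
by apply: filterS => z; apply; rewrite /= in_itv/= andbT.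
Qed.

Lemma continuous_half_sq_dist (R : realType) (X Y : normedModType R)
    (f : X -> Y) (y : Y) : continuous f -> continuous (half_sq_dist f y).
Proof.
move=> fc x; apply: cvgM; first exact: cvg_cst.
have fyc : `|f x' - y| @[x' --> x] --> `|f x - y|.
  by apply: cvg_norm; apply: cvgB; [exact: fc|exact: cvg_cst].
exact: cvgM.
Qed.

Lemma almost_critical_point (R : realType) (X : completeNormedModType R)
    (Y : normedModType R) (f : X -> Y) (h : R -> R) (y : Y) (e : R) :
  (forall x, differentiable f x) ->
  (forall r, 0 <= r -> 0 <= h r) ->
  {within `[0, +oo[, continuous h} ->
  {in `[0, +oo[ &, {homo h : r s / r <= s}} ->
  (\int[lebesgue_measure]_(rho in `[0%R, +oo[) ((1 + h rho)^-1)%:E = +oo)%E ->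
  0 < e -> (exists x, half_sq_dist f y x <= e) ->
  exists z, half_sq_dist f y z <= e /\
    clarke_lambda (half_sq_dist f y) z * (1 + h `|z|) <= e.
Proof.
move=> fd h0 hc hmono hint e0 [x0 x0e]; pose F := half_sq_dist f y.
have h1 r : 0 <= r -> 0 < 1 + h r by move=> /h0; lra.
have [Phi PhiB Phiy] := concave_potential h0 hc hmono hint.
(* Multiplied by [e], this level is the bound on the potential in [weighted_ekeland]. [Phi] is
   strictly increasing on the half-line, so points under that bound have norm at most [r] and weight
   at least [e / (1 + h r)]. *)
have [r r0 Mr] := Phiy (Phi `|x0| + F x0 / e).
have [| | | | | |z [zF _ zmin]] := @weighted_ekeland R X F
  (fun x => e * (1 + h `|x|)^-1) (fun x => e * Phi `|x|)
  (e * (1 + h r)^-1) x0.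
- apply: continuous_half_sq_dist => x; exact: differentiable_continuous.
- by move=> x; rewrite mulr_ge0 ?sqr_ge0.
- by move=> x; apply: cvgM; [exact: cvg_cst|exact: continuous_weight].
- move=> u v; rewrite -mulrBr -mulrA ler_pM2l//.
  apply: le_trans (PhiB _ _ (normr_ge0 u) (normr_ge0 v)) _.
  by rewrite ler_pM2l ?invr_gt0 ?h1// lerB_dist.
- by rewrite mulr_gt0 ?invr_gt0 ?h1.
- move=> x xM; rewrite ler_pM2l// lef_pV2 ?posrE ?h1// lerD2l.
  have Phix : Phi `|x| < Phi r.
    apply: le_lt_trans Mr; rewrite -(ler_pM2l e0) mulrDr.
    by rewrite [e * (_ / e)]mulrC divfK// gt_eqF.
  apply: hmono; rewrite ?in_itv/= ?andbT//.
  rewrite leNgt; apply/negP => rx.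
  have := PhiB `|x| r (normr_ge0 x) r0.
  have : 0 < (1 + h `|x|)^-1 * (`|x| - r).
    by rewrite mulr_gt0 ?invr_gt0 ?h1// subr_gt0.
  by lra.
exists z; split; first exact: le_trans zF x0e.
rewrite -ler_pdivlMr ?h1//; apply: clarke_lambda_le => //.
by rewrite divr_ge0 ?ltW ?h1.
Qed.

Lemma closed_range (R : realType) (X : completeNormedModType R)
    (Y : normedModType R) (f : X -> Y) (h : R -> R) :
  (forall x, differentiable f x) ->
  (forall r, 0 <= r -> 0 <= h r) ->
  {within `[0, +oo[, continuous h} ->
  {in `[0, +oo[ &, {homo h : r s / r <= s}} ->
  (\int[lebesgue_measure]_(rho in `[0%R, +oo[) ((1 + h rho)^-1)%:E = +oo)%E ->
  (forall (y : Y) (u : nat -> X),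
     half_sq_dist f y (u n) @[n --> \oo] --> (0 : R) ->
     clarke_lambda (half_sq_dist f y) (u n) * (1 + h `|u n|) @[n --> \oo]
       --> (0 : R) ->
     has_convergent_subseq u) ->
  closed (range f).
Proof.
move=> fd h0 hc hmono hint hPS y yf.
have /choice[u uP] (n : nat) : exists z, half_sq_dist f y z <= n.+1%:R^-1 /\
    clarke_lambda (half_sq_dist f y) z * (1 + h `|z|) <= n.+1%:R^-1.
  have n0 : 0 < n.+1%:R^-1 :> R by rewrite invr_gt0.
  apply: almost_critical_point => //.
  have [_ [[x _ <-]]] := yf (ball y n.+1%:R^-1) (nbhsx_ballx _ _ n0).
  rewrite -ball_normE /= distrC => fx; exists x; rewrite /half_sq_dist.
  (* With [b <= 1], [a < b] gives [a^2 / 2 <= b]. *)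
  have n1 : n.+1%:R^-1 <= 1 :> R by rewrite invf_le1 // ler1n.
  have := normr_ge0 (f x - y).
  set a := `|_| in fx *; set b := _^-1 in n0 n1 fx *.
  by move=> a0; nra.
have F0 x : 0 <= half_sq_dist f y x by rewrite mulr_ge0 ?sqr_ge0.
have squeeze (v : nat -> R) : (forall n, 0 <= v n <= n.+1%:R^-1) ->
    v n @[n --> \oo] --> (0 : R).
  move=> vP; apply: (@squeeze_cvgr _ _ _ _ (cst 0) (@harmonic R)).
  - exact: nearW.
  - exact: cvg_cst.
  - exact: cvg_harmonic.
have Fu : half_sq_dist f y (u n) @[n --> \oo] --> (0 : R).
  by apply: squeeze => n; rewrite F0 (uP n).1.
have [|phi [phi_incr /cvg_ex[x ux]]] := hPS y u Fu.
  apply: squeeze => n; rewrite (uP n).2 andbT mulr_ge0 ?clarke_lambda_ge0//.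
  by rewrite addr_ge0 ?h0.
exists x => //; apply/eqP; rewrite -subr_eq0 -normr_eq0 -sqrf_eq0.
have phiy : phi n @[n --> \oo] --> \oo.
  have le_phi n : (n <= phi n)%N.
    by elim: n => // n /leq_ltn_trans; apply; exact: phi_incr.
  apply/cvgnyPge => A; exists A => // n /= An; exact: leq_trans (le_phi n).
have Fphi : half_sq_dist f y (u (phi n)) @[n --> \oo] --> (0 : R).
  exact: (cvg_comp phi _ phiy Fu).
have Fx : half_sq_dist f y (u (phi n)) @[n --> \oo] --> half_sq_dist f y x.
  have fc : continuous f by move=> x'; exact: differentiable_continuous.
  have Fc := continuous_half_sq_dist (y := y) fc.
  by apply: (cvg_comp _ _ ux); exact: Fc.
have : half_sq_dist f y x = 0 by exact: cvg_unique Fx Fphi.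
by move=> /eqP; rewrite mulf_eq0 invr_eq0 pnatr_eq0.
Qed.

Theorem theorem9 (R : realType) (X Y : completeNormedModType R) (f : X -> Y)
  (hf : local_C1_diffeomorphism f)
  (h : R -> R)
  (h_ge0 : forall r, 0 <= r -> 0 <= h r)
  (h_cont : {within `[0, +oo[, continuous h})
  (h_nondecr : {in `[0, +oo[ &, {homo h : r s / r <= s}})
  (h_int : (\int[lebesgue_measure]_(rho in `[0%R, +oo[)
              ((1 + h rho)^-1)%:E = +oo)%E)
  (hPS : forall (y : Y) (u : nat -> X),
     half_sq_dist f y (u n) @[n --> \oo] --> (0 : R) ->
     clarke_lambda (half_sq_dist f y) (u n) * (1 + h `|u n|) @[n --> \oo]
       --> (0 : R) ->
     has_convergent_subseq u) :
  forall y : Y, exists x : X, f x = y.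

Proof.
have [[fd _] _] := hf.
have rT : range f = setT.
  apply: connected_range; first by exists (f 0), 0.
  - rewrite openE => _ [x _ <-]; have [d d0 dP] := local_surjection x hf.
    apply/nbhs_ballP; exists d => // y; rewrite -ball_normE => /dP[z <-].
    by exists z.
  - exact: closed_range h_ge0 h_cont h_nondecr h_int hPS.
by move=> y; have : range f y; [rewrite rT|move=> [x _ <-]; exists x].
Qed.
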